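(* Let $\mathbf k$ be a non-archimedean local field of characteristic different from $2$ and let $\bar\alpha\in\mathbf k^*/(\mathbf k^* )^2$ be such that $-1\notin\bar\alpha$. Then the following two subsets of $\mathbf k^3$ are equal: \begin{enumerate} \item $\bigcup_{\alpha\in\bar\alpha} K_{\bar\alpha}\,\mathrm{Ad}(\mathrm{PSL}(2,\mathbf k))\cdot v_\alpha$; \item $\mathcal H_{\bar\alpha}=\{v\in\mathbf k^3 : \text{for all } w\in\mathcal C_{\bar 1},\ B(v,w)\in K_{\bar\alpha}\}$. \end{enumerate} Moreover $\mathcal H_{\bar\alpha}$ is the union of one or two $K_{\bar\alpha}\mathrm{Ad}(\mathrm{PSL}(2,\mathbf k))$-orbits: two if $-1$ belongs to $K_{\bar\alpha}$, and one otherwise.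
   Context: Elements of $\mathbf k^*/(\mathbf k^* )^2$ are regarded as subsets (cosets) of $\mathbf k^*$. Let $Q(x,y,z)=xz-y^2$ on $\mathbf k^3$ and let $B(v,v')=\frac12[Q(v+v')-Q(v-v')]$ (so $B((x,y,z),(x',y',z'))=xz'+zx'-2yy'$). $\mathrm{PSL}(2,\mathbf k)$ denotes the image of $\mathrm{SL}(2,\mathbf k)$ in $\mathrm{PGL}(2,\mathbf k)$, and $\mathrm{Ad}:\mathrm{PGL}(2,\mathbf k)\to \mathrm{SL}(3,\mathbf k)$ is the adjoint representation, which is an isomorphism onto $\mathrm{SO}(Q)$. Concretely, identifying $(x,y,z)$ with the symmetric matrix $S=\begin{pmatrix}x & y \\ y & z\end{pmatrix}$, $\mathrm{Ad}(g)S=\det(g)^{-1}\,gS\,{}^tg$. For $\alpha\in\mathbf k^*$, $v_\alpha=(\alpha,0,1)\in\mathbf k^3$. For $\bar\alpha$ with $-1\notin\bar\alpha$, $K_{\bar\alpha}=\{\alpha x^2+y^2\in\mathbf k^* : x,y\in\mathbf k^*\}$ for any $\alpha\in\bar\alpha$; it is an index $2$ subgroup of $\mathbf k^*$ independent of the choice of $\alpha\in\bar\alpha$. It acts on $\mathbf k^3$ by homotheties. $\mathcal C_{\bar1}=\{(a,b,c)\in\mathbf k^3\setminus\{0\}: ac=b^2,\ a \text{ and } c \text{ are squares in }\mathbf k\ (\text{possibly }0)\}$. *)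

(* Defs.v *)
From HB Require Import structures.
From mathcomp Require Import all_boot all_order all_algebra.
From mathcomp Require Import boolp classical_sets.
From mathcomp Require Import ring.
Set Implicit Arguments.
Unset Strict Implicit.
Unset Printing Implicit Defensive.
Import Order.TTheory GRing.Theory Num.Theory.
Local Open Scope classical_set_scope.
Local Open Scope ring_scope.

(* A non-archimedean local field is a field that is complete for a (normalized)
   discrete valuation with finite residue field.  The valuation is a function
   k -> int whose value at 0 is irrelevant: [val_ge v N x] says v(x) >= N with
   the convention v(0) = +oo, i.e. that x lies in the N-th power of the maximal
   ideal. *)
Definition val_ge (k : fieldType) (v : k -> int) (N : int) (x : k) : Prop :=
  x = 0 \/ N <= v x.

Record discrete_valuation (k : fieldType) (v : k -> int) : Prop := {
  valM : forall x y, x != 0 -> y != 0 -> v (x * y) = v x + v y;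
  valD : forall N x y, val_ge v N x -> val_ge v N y -> val_ge v N (x + y);
  val_uniformizer : exists2 p, p != 0 & v p = 1
}.

Definition val_complete (k : fieldType) (v : k -> int) : Prop :=
  forall u : nat -> k,
    (forall N : int, exists n0 : nat, forall m n : nat,
        (n0 <= m)%N -> (n0 <= n)%N -> val_ge v N (u m - u n)) ->
    exists l : k, forall N : int, exists n0 : nat, forall n : nat,
        (n0 <= n)%N -> val_ge v N (u n - l).

Definition finite_residue_field (k : fieldType) (v : k -> int) : Prop :=
  exists s : seq k, forall x, val_ge v 0 x ->
    exists2 y, y \in s & val_ge v 1 (x - y).

Definition nonarch_local_field (k : fieldType) : Prop :=
  exists v : k -> int,
    [/\ discrete_valuation v, val_complete v & finite_residue_field v].

(* The elements of k^* / (k^* )^2, as subsets of k. *)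
Definition square_class (k : fieldType) (abar : set k) : Prop :=
  exists2 a : k, a != 0 & abar = [set a * t ^+ 2 | t in [set t | t != 0]].

Definition vec3 (k : fieldType) (x y z : k) : 'rV[k]_3 :=
  \row_i [:: x; y; z]`_i.

Definition qform (k : fieldType) (v : 'rV[k]_3) : k :=
  v 0 0 * v 0 2 - v 0 1 ^+ 2.

Definition bform (k : fieldType) (v w : 'rV[k]_3) : k :=
  2^-1 * (qform (v + w) - qform (v - w)).

Lemma bformE (k : fieldType) (v w : 'rV[k]_3) : 2%N \notin [pchar k] ->
  bform v w = v 0 0 * w 0 2 + v 0 2 * w 0 0 - 2 * v 0 1 * w 0 1.
Proof.
move=> c2; have n2 : (2 : k) != 0 by move: c2; rewrite inE /= .
by rewrite /bform /qform !mxE; field.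
Qed.

(* The symmetric matrix with entries x, y; y, z, for v = (x, y, z). *)
Definition sym2 (k : fieldType) (v : 'rV[k]_3) : 'M[k]_2 :=
  \matrix_(i, j) [:: v 0 0; v 0 1; v 0 2]`_(i + j).

Definition unsym2 (k : fieldType) (S : 'M[k]_2) : 'rV[k]_3 :=
  vec3 (S 0 0) (S 0 1) (S 1 1).

Definition Ad (k : fieldType) (g : 'M[k]_2) (v : 'rV[k]_3) : 'rV[k]_3 :=
  unsym2 ((\det g)^-1 *: (g *m sym2 v *m g^T)).

Lemma vec3E (k : fieldType) (v : 'rV[k]_3) : v = vec3 (v 0 0) (v 0 1) (v 0 2).
Proof.
apply/rowP=> i; rewrite mxE; case: i => [[|[|[|//]]] hi] /=;
by congr (fun_of_matrix v _ _); apply: val_inj.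
Qed.

Lemma sym2K (k : fieldType) (S : 'M[k]_2) : S^T = S -> sym2 (unsym2 S) = S.
Proof.
move=> ST; have S10 : S 1 0 = S 0 1 by rewrite -[in LHS]ST mxE.
apply/matrixP=> i j; rewrite !mxE.
have inj (a b c d : 'I_2) : a = c :> nat -> b = d :> nat -> S a b = S c d.
  by move=> /val_inj -> /val_inj ->.
case: i => [[|[|//]] hi]; case: j => [[|[|//]] hj] /=; last exact: inj.
- exact: inj.
- exact: inj.
- by rewrite -S10; apply: inj.
Qed.

Lemma tr_sym2 (k : fieldType) (v : 'rV[k]_3) : (sym2 v)^T = sym2 v.
Proof. by apply/matrixP=> i j; rewrite !mxE addnC. Qed.

Lemma sym2_Ad (k : fieldType) (g : 'M[k]_2) (v : 'rV[k]_3) :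
  sym2 (Ad g v) = (\det g)^-1 *: (g *m sym2 v *m g^T).
Proof.
by rewrite sym2K // linearZ /= !trmx_mul trmxK tr_sym2 mulmxA.
Qed.

(* [Ad] factors through PGL(2, k), so the image under it of PSL(2, k), itself the
   image of SL(2, k) in PGL(2, k), is the image of SL(2, k). *)
Lemma AdZ (k : fieldType) (c : k) (g : 'M[k]_2) : c != 0 -> Ad (c *: g) = Ad g.
Proof.
move=> c0; apply/funext=> v; rewrite /Ad detZ; congr unsym2.
rewrite linearZ /= -!scalemxAl -scalemxAr -?scalemxAl !scalerA; congr (_ *: _).
by rewrite invfM mulrAC -mulrA -expr2 mulrC mulrA mulfV ?mul1r // expf_neq0.
Qed.

Definition AdPSL2 (k : fieldType) : set ('rV[k]_3 -> 'rV[k]_3) :=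
  [set Ad g | g in [set g : 'M[k]_2 | \det g = 1]].

Definition valpha (k : fieldType) (a : k) : 'rV[k]_3 := vec3 a 0 1.

Definition Kgroup (k : fieldType) (abar : set k) : set k :=
  [set c | c != 0 /\ exists a x y,
     [/\ abar a, x != 0, y != 0 & c = a * x ^+ 2 + y ^+ 2]].

(* Any representative of the square class defines the same set. *)
Lemma KgroupE (k : fieldType) (abar : set k) (a : k) :
  square_class abar -> abar a ->
  Kgroup abar = [set c | c != 0 /\ exists x y,
     [/\ x != 0, y != 0 & c = a * x ^+ 2 + y ^+ 2]].
Proof.
case=> b b0 -> [t /= t0 <-]; apply/seteqP; split=> c /= [c0].
  case=> a1 [x] [y] [[u u0 <-] x0 y0 cE]; split=> //.
  exists (u * x / t), y; split=> //; first by rewrite !mulf_neq0 ?invr_neq0.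
  by rewrite cE; field.
case=> x [y] [x0 y0 cE]; split=> //.
by exists (b * t ^+ 2), x, y; split=> //; exists t.
Qed.

Definition KAdPSL2 (k : fieldType) (abar : set k) : set ('rV[k]_3 -> 'rV[k]_3) :=
  [set (fun v => c *: f v) | c in Kgroup abar & f in @AdPSL2 k].

Definition orbit_of (k : fieldType) (G : set ('rV[k]_3 -> 'rV[k]_3))
  (v : 'rV[k]_3) : set 'rV[k]_3 := [set f v | f in G].

Definition is_square (k : fieldType) (a : k) : Prop := exists s, a = s ^+ 2.

Definition cone1 (k : fieldType) : set 'rV[k]_3 :=
  [set w | w != 0 /\ exists a b c,
     [/\ w = vec3 a b c, a * c = b ^+ 2, is_square a & is_square c]].

Definition Hset (k : fieldType) (abar : set k) : set 'rV[k]_3 :=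
  [set v | forall w, cone1 w -> Kgroup abar (bform v w)].

(* Main.v *)
(* Write N_a for the nonzero values of x^2 - a y^2, so that K is N_(-alpha).
   - The arithmetic input is that N_a has index exactly 2 in k^* for a nonsquare a,
     and that N_d contained in N_a forces a d to be a square.  Take a unit
     Delta = 1 + 4 rho with rho not of the form t^2 + t in the residue field:
     N_Delta consists of the elements of even valuation.  By successive
     approximation and the fact that 1 + 4 w is a square for w in the maximal
     ideal, N_a and Delta N_a cover k^* when a has odd valuation.  The relation
     c in N_a is symmetric in a and c, and multiplicative in both; since every a
     outside the classes of 1 and Delta has a norm of odd valuation, the general
     case reduces to these two.
   - For v = (x, y, z) in H, the numbers B(v, w) are the values of the binary form
     z s^2 - 2 y s t + x t^2.  Completing the square gives v = z Ad(g) v_a with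
     a = Q(v) / z^2, g unipotent and N_(-a) contained in K, so a is in the class
     of alpha.
   - v_(alpha t^2) lies in the orbit of v_alpha as soon as t is in K, and
     conversely Q shows that then t is in K or in -K.  So the orbits are indexed
     by the quotient of k^* by the subgroup generated by K and -1. *)
From HB Require Import structures.
Require Import Defs.
From mathcomp Require Import all_boot all_order all_algebra.
From mathcomp Require Import zify ring.
Set Implicit Arguments.
Unset Strict Implicit.
Unset Printing Implicit Defensive.
Import Order.TTheory GRing.Theory Num.Theory.
Local Open Scope ring_scope.

(** * Counting in finite fields *)

(** Every fibre of [f] lies in a pair x, [sigma x]; the sizes of the fibres are summed over the
    image. *)
Lemma card_le_double_imset (T T' : finType) (f : T -> T') (sigma : T -> T)
    (A : {set T}) :
  (forall x y, f x = f y -> y = x \/ y = sigma x) ->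
  (#|A| <= 2 * #|f @: A|)%N.
Proof.
move=> fE; rewrite -sum1_card (partition_big_imset f) /= mulnC -sum_nat_const.
apply: leq_sum => y /imsetP[x xA ->]; rewrite sum1dep_card.
apply: leq_trans (_ : #|[set x; sigma x]| <= 2)%N; last by rewrite cards2; case: eqP.
apply/subset_leq_card/subsetP=> z; rewrite !inE => /andP[_ /eqP/esym/fE].
by case=> ->; rewrite eqxx ?orbT.
Qed.

Section FiniteField.
Variable F : finFieldType.
Implicit Types (t u x y : F).

Local Notation AS := [set t ^+ 2 + t | t : F].

Lemma artin_schreier_fiber x y :
  x ^+ 2 + x = y ^+ 2 + y -> y = x \/ y = - 1 - x.
Proof.
move=> e; have /eqP : (y - x) * (y + x + 1) = 0.
  have -> : (y - x) * (y + x + 1) = (y ^+ 2 + y) - (x ^+ 2 + x) by ring.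
  by rewrite e subrr.
rewrite mulf_eq0 => /orP[/eqP|/eqP] e'; [left | right].
  by rewrite -[x]add0r -e' subrK.
by rewrite -[y]subr0 -e'; ring.
Qed.

(** A self-map of a finite set that is not injective is not onto, and t^2 + t vanishes at both 0 and
    -1. *)
Lemma artin_schreier_missed : exists rho : F, forall t, rho != t ^+ 2 + t.
Proof.
suff [rho rhoN] : exists rho, rho \notin AS.
  by exists rho => t; apply: contraNneq rhoN => ->; apply/imsetP; exists t.
have [/subsetP AT|/subsetPn[rho _ rhoN]] := boolP ([set: F] \subset AS);
  last by exists rho.
have /imset_injP inj : #|[set t ^+ 2 + t | t in [set: F]]| == #|[set: F]|.
  apply/eqP/eq_card=> x; rewrite inE; have := AT x (in_setT _) => /imsetP[t _ ->].
  by apply/imset_f; rewrite inE.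
have /eqP : (0 : F) = -1 by apply: inj; rewrite ?in_setT //; ring.
by rewrite eq_sym oppr_eq0 oner_eq0.
Qed.

Lemma char2_square : (2 : F) = 0 -> forall u, exists s, u = s ^+ 2.
Proof.
move=> F2 u; have inj : injective (fun x : F => x ^+ 2).
  move=> x y e; apply/eqP; rewrite -subr_eq0 -sqrf_eq0 sqrrB e.
  by rewrite -mulrnAr -mulr_natr F2 !mulr0 subr0 -mulr2n -mulr_natr F2 mulr0.
by exists (invF inj u); rewrite (f_invF inj).
Qed.

Lemma card_artin_schreier : (#|F| <= 2 * #|AS|)%N.
Proof.
have := @card_le_double_imset F F (fun t => t ^+ 2 + t) _ [set: F]
  artin_schreier_fiber.
rewrite cardsT => /leq_trans; apply; rewrite leq_mul2l.
by apply/subset_leq_card/subsetP=> _ /imsetP[t _ ->]; apply/imset_f.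
Qed.

(** Pigeonhole: t^2 + t takes at least half of the elements of [F] as values, and rho + b y^2 more
    than half because 0 is alone in its fibre, so the two share a value. *)
Lemma artin_schreier_norm_onto (b rho : F) :
  b != 0 -> exists x y, rho = x ^+ 2 + x - b * y ^+ 2.
Proof.
move=> b0; pose g y := rho + b * y ^+ 2.
have gE x y : g x = g y -> y = x \/ y = - x.
  move=> /addrI/(mulfI b0)/esym/eqP; rewrite eqf_sqr.
  by case/orP=> /eqP; [left | right].
have B0 : (#|F| < 2 * #|g @: [set: F]|)%N.
  have /= := card_le_double_imset [set~ 0] gE.
  rewrite cardsC1 => le1.
  have /subset_leq_card : (g 0 |: g @: [set~ 0] \subset g @: [set: F]).
    apply/subsetP=> z; rewrite !inE => /orP[/eqP ->|/imsetP[y _ ->]]; exact/imset_f.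
  rewrite cardsU1 => le2.
  have g0 : g 0 \notin g @: [set~ 0].
    apply/imsetP=> -[y]; rewrite !inE => y0 /gE[]; rewrite ?oppr0 => yE;
    by rewrite yE eqxx in y0.
  have F0 : (0 < #|F|)%N by apply/card_gt0P; exists 0.
  move: le1 le2 F0; rewrite g0 /=; set n1 := #|F|.
  set n2 := #|_ @: [set~ 0]|; set n3 := #|_ @: _|; lia.
have [z] : exists z, z \in AS :&: g @: [set: F].
  apply/set0Pn/negP=> /eqP e; have := cardsUI AS (g @: [set: F]).
  rewrite e cards0 addn0; have := max_card (mem (AS :|: g @: [set: F])).
  move: B0 card_artin_schreier; set n1 := #|F|; set n2 := #|AS|.
  set n3 := #|_ @: _|; set four_neq0 := #|_ :|: _|; lia.
rewrite inE => /andP[/imsetP[x _ ->] /imsetP[y _ e]].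
by exists x, y; rewrite e /g addrK.
Qed.

(* [1 + 4 (t^2 + t) = (1 + 2 t)^2], so in odd characteristic this says that the
   product of two non-squares is a square. *)
Lemma artin_schreier_index2 (u rho : F) :
  (forall t, u != t ^+ 2 + t) -> (forall t, rho != t ^+ 2 + t) ->
  exists t, rho = u + (t ^+ 2 + t) * (1 + 4 * u).
Proof.
move=> uN rhoN; pose f t := t ^+ 2 + t; pose g t := u + (t ^+ 2 + t) * (1 + 4 * u).
have half t : 1 + 2 * t = 0 -> 1 + 4 * (t ^+ 2 + t) = 0.
  move=> e; have -> : 1 + 4 * (t ^+ 2 + t) = (1 + 2 * t) ^+ 2 by ring.
  by rewrite e expr0n.
(* 1 + 4x = 0 would force x = -1/4, the value of t^2 + t at t = -1/2. *)
have NAS x : (forall t, x != t ^+ 2 + t) -> 1 + 4 * x != 0.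
  move=> xN; apply: contraT; rewrite negbK => /eqP e.
  have n2 : (2 : F) != 0.
    apply/eqP=> F2; move: e; have -> : 4 = 2 * 2 :> F by ring.
    by rewrite F2 !mul0r addr0 => /eqP; rewrite oner_eq0.
  rewrite -(negbTE (xN (- 2^-1))); apply/eqP; apply: (mulfI (_ : (4 : F) != 0)).
    by have -> : 4 = 2 * 2 :> F by [ring]; rewrite mulf_neq0.
  rewrite -[LHS](addKr 1) e; field; exact: n2.
have u4 := NAS u uN; have rho4 := NAS rho rhoN.
have gE x y : g x = g y -> y = x \/ y = - 1 - x.
  by move=> /addrI/(mulIf u4); exact: artin_schreier_fiber.
(* Both [f] and [g] send [Z] into [W] with fibres of size at most two, and their images are
   disjoint. As [W] is no larger than [Z], the two images fill [W]. *)
pose Z := [set t : F | 1 + 2 * t != 0].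
pose W := [set t : F | 1 + 4 * t != 0].
have leWZ : (#|W| <= #|Z|)%N.
  have [F2|n2] := eqVneq (2 : F) 0.
    apply/subset_leq_card/subsetP=> z _; by rewrite inE F2 mul0r addr0 oner_eq0.
  rewrite -(card_imset _ (mulfI n2)); apply/subset_leq_card/subsetP.
  by move=> _ /imsetP[z zW ->]; move: zW; rewrite !inE mulrA -natrM.
have fW : f @: Z \subset W.
  apply/subsetP=> _ /imsetP[t tZ ->]; move: tZ; rewrite !inE.
  move=> t0; have -> : 1 + 4 * f t = (1 + 2 * t) ^+ 2 by rewrite /f; ring.
  by rewrite expf_neq0.
have gW : g @: Z \subset W.
  apply/subsetP=> _ /imsetP[t tZ ->]; move: tZ; rewrite !inE.
  move=> t0; have -> : 1 + 4 * g t = (1 + 2 * t) ^+ 2 * (1 + 4 * u).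
    by rewrite /g; ring.
  by rewrite mulf_neq0 ?expf_neq0.
have dis : (f @: Z) :&: (g @: Z) = set0.
  apply/setP=> z; rewrite !inE; apply/negP=> /andP[/imsetP[t tZ ->] /imsetP[s sZ e]].
  (* In odd characteristic f t = g s reads (1 + 2t)^2 = (1 + 2s)^2 (1 + 4u); writing (1 + 2t)/(1 +
     2s) as 1 + 2r gives r = (t - s)/(1 + 2s) and u = r^2 + r. The same r works in characteristic
     2. *)
  move: sZ tZ; rewrite !inE => s0 t0; have /eqP := uN ((t - s) / (1 + 2 * s)); apply.
  have -> : u = (f t - (s ^+ 2 + s)) / (1 + 2 * s) ^+ 2 by rewrite e /g; field.
  by rewrite /f; field.
have fgW : f @: Z :|: g @: Z = W.
  apply/eqP; rewrite eqEcard subUset fW gW /=.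
  have := cardsUI (f @: Z) (g @: Z); rewrite dis cards0 addn0 => ->.
  have := card_le_double_imset Z artin_schreier_fiber; rewrite -/f.
  have := card_le_double_imset Z gE; rewrite -/g.
  move: leWZ; set n1 := #|W|; set n2 := #|Z|; set n3 := #|f @: Z|.
  set four_neq0 := #|g @: Z|; lia.
have : rho \in W by rewrite inE.
rewrite -fgW inE => /orP[/imsetP[t _ e]|/imsetP[t _ e]]; last by exists t.
by have := rhoN t; rewrite {1}e eqxx.
Qed.

End FiniteField.

(* Imported only now: [classical_sets] shadows the finite sets used above. *)
From mathcomp Require Import boolp classical_sets.
Import Order.TTheory GRing.Theory Num.Theory.
Local Open Scope classical_set_scope.
Local Open Scope ring_scope.

(** * Discrete valuations and the residue field *)

Section Valuation.
Variables (k : fieldType) (v : k -> int).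
Hypothesis dv : discrete_valuation v.
Implicit Types (x y : k) (M N : int).

Local Notation vg := (val_ge v).

Lemma dval1 : v 1 = 0.
Proof.
have := Defs.valM dv (oner_neq0 k) (oner_neq0 k); rewrite mulr1 => e.
by apply: (addIr (v 1)); rewrite -e add0r.
Qed.

Lemma dvalN x : v (- x) = v x.
Proof.
have [->|x0] := eqVneq x 0; first by rewrite oppr0.
have N10 : (-1 : k) != 0 by rewrite oppr_eq0 oner_neq0.
have := Defs.valM dv N10 N10; rewrite mulrNN mulr1 dval1 => e.
have vN1 : v (-1) = 0 by lia.
by rewrite -mulN1r (Defs.valM dv) // vN1 add0r.
Qed.

Lemma dvalV x : x != 0 -> v x^-1 = - v x.
Proof.
move=> x0; have := Defs.valM dv x0 (_ : x^-1 != 0); rewrite invr_eq0 mulfV // dval1.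
by move=> /(_ x0) e; lia.
Qed.

Lemma dvalX x n : x != 0 -> v (x ^+ n) = v x * n%:Z.
Proof.
move=> x0; elim: n => [|n IH]; first by rewrite expr0 dval1 mulr0.
rewrite exprS (Defs.valM dv) ?expf_neq0 // IH; lia.
Qed.

Lemma val_ge0 N : vg N 0. Proof. by left. Qed.

Lemma val_geE N x : x != 0 -> vg N x <-> N <= v x.
Proof. by move=> x0; split=> [[e|//]|]; [rewrite e eqxx in x0 | right]. Qed.

Lemma val_ge_val x : vg (v x) x. Proof. by right. Qed.

Lemma val_geW M N x : M <= N -> vg N x -> vg M x.
Proof. by move=> le [->|h]; [left | right; apply: le_trans h]. Qed.

Lemma val_geN N x : vg N x -> vg N (- x).
Proof. by move=> [->|h]; [left; rewrite oppr0 | right; rewrite dvalN]. Qed.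

Lemma val_geD N x y : vg N x -> vg N y -> vg N (x + y).
Proof. exact: Defs.valD. Qed.

Lemma val_geB N x y : vg N x -> vg N y -> vg N (x - y).
Proof. by move=> hx /val_geN; apply: val_geD. Qed.

Lemma val_geM M N x y : vg M x -> vg N y -> vg (M + N) (x * y).
Proof.
move=> hx hy; have [->|x0] := eqVneq x 0; first by rewrite mul0r; left.
have [->|y0] := eqVneq y 0; first by rewrite mulr0; left.
move: hx hy; rewrite !val_geE ?mulf_neq0 // (Defs.valM dv) //; exact: lerD.
Qed.

Lemma val_ge1 : vg 0 1. Proof. by right; rewrite dval1. Qed.

Lemma val_geM0 x y : vg 0 x -> vg 0 y -> vg 0 (x * y).
Proof. exact: val_geM. Qed.

Lemma val_ge_nat n : vg 0 n%:R.
Proof.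
elim: n => [|n IH]; first exact: val_ge0.
by rewrite -natr1; apply: val_geD IH val_ge1.
Qed.

Lemma val_geX x n : vg 0 x -> vg 0 (x ^+ n).
Proof.
move=> hx; elim: n => [|n IH]; first exact: val_ge1.
by rewrite exprS; apply: val_geM0.
Qed.

Lemma val_ge_div N x y : y != 0 -> vg N x -> vg (N - v y) (x / y).
Proof.
move=> y0 hx; apply: val_geM => //; rewrite -dvalV //; exact: val_ge_val.
Qed.

Lemma val_dom x y : x != 0 -> vg (v x + 1) y -> x + y != 0 /\ v (x + y) = v x.
Proof.
move=> x0 hy; have nlt : ~ vg (v x + 1) (x + y).
  move=> h; have := val_geB h hy; rewrite addrK val_geE //; lia.
have n0 : x + y != 0 by apply/eqP=> e; apply: nlt; rewrite e; left.
split=> //; have : vg (v x) (x + y).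
  by apply: val_geD; [exact: val_ge_val | apply: val_geW hy; lia].
move: nlt; rewrite !val_geE //; lia.
Qed.

Lemma val_unit x : vg 0 x -> ~ vg 1 x -> x != 0 /\ v x = 0.
Proof.
move=> h0 h1; have x0 : x != 0 by apply/eqP=> e; apply: h1; rewrite e; left.
split=> //; move: h0 h1; rewrite !val_geE //; lia.
Qed.

(** The first entry of the list congruent to x depends only on the class of x. The integral entries
    that are their own first congruent entry represent each class exactly once. *)
Lemma residue_representatives : finite_residue_field v ->
  exists (T : finType) (cls : k -> T) (rep : T -> k),
    [/\ forall t, vg 0 (rep t), forall t, cls (rep t) = t,
        forall x, vg 0 x -> vg 1 (x - rep (cls x)) &
        forall x y, vg 0 x -> vg 0 y -> vg 1 (x - y) -> cls x = cls y].
Proof.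
case=> s hs; pose r x := nth 0 s (find (fun y => `[<vg 1 (x - y)>]) s).
have rP x : vg 0 x -> r x \in s /\ vg 1 (x - r x).
  move=> /hs[y ys hy].
  have hasy : has (fun y => `[<vg 1 (x - y)>]) s.
    by apply/hasP; exists y => //; apply/asboolP.
  by split; [rewrite mem_nth // -has_find | apply/asboolP; exact: (nth_find 0 hasy)].
have rE x y : vg 1 (x - y) -> r x = r y.
  move=> hxy; congr nth; apply: eq_find => z; apply: asbool_equiv_eq.
  split=> h; last by rewrite -(subrKA y); apply: val_geD.
  by rewrite -(subrKA x) -(opprB x); apply: val_geD => //; exact: val_geN.
have rO x : vg 0 x -> vg 0 (r x).
  move=> hx; have [_ h] := rP x hx; rewrite -(subKr x (r x)).
  by apply: val_geB => //; apply: val_geW h.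
pose R := [seq y <- s | `[<vg 0 y /\ r y = y>]].
have rR x : vg 0 x -> r x \in R.
  move=> hx; rewrite mem_filter (rP x hx).1 andbT; apply/asboolP.
  by split; [exact: rO | apply/esym/rE; exact: (rP x hx).2].
pose t0 : seq_sub R := SeqSub (rR 0 (val_ge0 0)).
have val_cls x : vg 0 x -> val (insubd t0 (r x)) = r x.
  by move=> hx; rewrite insubdK ?rR.
have repP (t : seq_sub R) : vg 0 (val t) /\ r (val t) = val t.
  by have := valP t; rewrite mem_filter => /andP[/asboolP].
exists (seq_sub R), (fun x => insubd t0 (r x)), val; split.
- by move=> t; have [] := repP t.
- by move=> t; have [h e] := repP t; apply: val_inj; rewrite val_cls.
- by move=> x hx; rewrite val_cls //; have [] := rP x hx.
- by move=> x y _ _ /rE ->.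
Qed.

(** The field structure is transported to the finite type of representatives. The reduction [phi] is
    total on [k] but meaningful only on the valuation ring, whence the integrality hypotheses. *)
Lemma residue_field : finite_residue_field v ->
  exists (F : finFieldType) (phi : k -> F),
    [/\ forall x y, vg 0 x -> vg 0 y -> phi (x + y) = phi x + phi y,
        forall x y, vg 0 x -> vg 0 y -> phi (x * y) = phi x * phi y,
        forall x, vg 0 x -> phi (- x) = - phi x,
        forall n, phi n%:R = n%:R
      & (forall x, vg 0 x -> phi x = 0 <-> vg 1 x) /\
        forall a, exists2 x, vg 0 x & phi x = a].
Proof.
move=> /residue_representatives[T [cls [rep [repO repK clsK clsE]]]].
have clsP x y : vg 0 x -> vg 0 y -> cls x = cls y <-> vg 1 (x - y).
  move=> hx hy; split; last exact: clsE.
  move=> e; rewrite -(subrKA (rep (cls x))); apply: val_geD; first exact: clsK.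
  by rewrite e -opprB; apply: val_geN; apply: clsK.
have surj a : exists2 x, vg 0 x & cls x = a by exists (rep a).
pose zero := cls 0; pose one := cls 1.
pose opp a := cls (- rep a).
pose add a b := cls (rep a + rep b); pose mul a b := cls (rep a * rep b).
pose inv a := if a == zero then zero else cls (rep a)^-1.
have clsD x y : vg 0 x -> vg 0 y -> cls (x + y) = add (cls x) (cls y).
  move=> hx hy; apply/clsP; try exact: val_geD.
  by rewrite opprD addrACA; apply: val_geD; apply: clsK.
have clsM x y : vg 0 x -> vg 0 y -> cls (x * y) = mul (cls x) (cls y).
  move=> hx hy; apply/clsP; try exact: val_geM0.
  set x' := rep _; set y' := rep _.
  have -> : x * y - x' * y' = (x - x') * y + x' * (y - y') by ring.
  apply: val_geD; first by apply: (@val_geM 1 0) => //; apply: clsK.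
  by apply: (@val_geM 0 1) => //; [apply: repO | apply: clsK].
have clsN x : vg 0 x -> cls (- x) = opp (cls x).
  move=> hx; apply/clsP; try exact: val_geN.
  by rewrite -opprD; apply: val_geN; apply: clsK.
have O0 := val_ge0 0; have O1 := val_ge1.
have addA : associative add.
  move=> a b c; have [x hx <-] := surj a; have [y hy <-] := surj b.
  by have [z hz <-] := surj c; rewrite -!clsD ?addrA //; apply: val_geD.
have addC : commutative add by move=> a b; rewrite /add addrC.
have add0 : left_id zero add.
  by move=> a; have [x hx <-] := surj a; rewrite -clsD ?add0r.
have addN : left_inverse zero opp add.
  move=> a; have [x hx <-] := surj a.
  by rewrite -clsN // -clsD ?addNr //; apply: val_geN.
have mulA : associative mul.
  move=> a b c; have [x hx <-] := surj a; have [y hy <-] := surj b.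
  by have [z hz <-] := surj c; rewrite -!clsM ?mulrA //; apply: val_geM0.
have mulC : commutative mul by move=> a b; rewrite /mul mulrC.
have mul1 : left_id one mul.
  by move=> a; have [x hx <-] := surj a; rewrite -clsM ?mul1r.
have mulD : left_distributive mul add.
  move=> a b c; have [x hx <-] := surj a; have [y hy <-] := surj b.
  have [z hz <-] := surj c.
  have hxy := val_geD hx hy.
  rewrite -(clsD _ _ hx hy) -!clsM // mulrDl clsD //; exact: val_geM0.
have cls0P x : vg 0 x -> cls x = zero <-> vg 1 x.
  by move=> hx; rewrite clsP // subr0.
have one0 : one != zero.
  by apply/eqP=> /(cls0P _ O1); rewrite val_geE ?oner_neq0 // dval1.
have mulV a : a != zero -> mul (inv a) a = one.
  move=> a0; rewrite /inv (negbTE a0).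
  have [r0 vr] : rep a != 0 /\ v (rep a) = 0.
    by apply: val_unit => // /cls0P; rewrite repK => /(_ (repO a))/eqP;
      rewrite (negbTE a0).
  have rV : vg 0 (rep a)^-1 by right; rewrite dvalV // vr.
  by rewrite -[X in mul _ X]repK -(clsM _ _ rV (repO a)) mulVf.
have inv0 : inv zero = zero by rewrite /inv eqxx.
pose Z : zmodType := HB.pack T (GRing.isZmodule.Build T addA addC add0 addN).
pose R : comNzRingType := HB.pack T Z
  (GRing.Zmodule_isComNzRing.Build Z mulA mulC mul1 mulD one0).
pose F : finFieldType := HB.pack T R (GRing.ComNzRing_isField.Build R mulV inv0).
exists F, cls; split=> //; elim=> [//|n IH].
by rewrite -!natr1 clsD ?IH //; exact: val_ge_nat.
Qed.

End Valuation.

(** * Norm groups of quadratic extensions *)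

Section NormGroup.
Variable k : fieldType.
Implicit Types a b c s : k.

(** For a nonsquare [a] these are the nonzero norms from k(sqrt a); for nonzero [a] and [c] in
    characteristic not 2, the relation is the triviality of the Hilbert symbol (a, c). *)
Definition is_norm a c := c != 0 /\ exists x y, c = x ^+ 2 - a * y ^+ 2.

Lemma is_norm_sqr a s : s != 0 -> is_norm a (s ^+ 2).
Proof.
by move=> s0; split; [rewrite expf_neq0 | exists s, 0; rewrite expr0n mulr0 subr0].
Qed.

Lemma is_normM a b c : is_norm a b -> is_norm a c -> is_norm a (b * c).
Proof.
move=> [b0 [x [y bE]]] [c0 [z [w cE]]]; split; first by rewrite mulf_neq0.
by exists (x * z + a * y * w), (x * w + y * z); rewrite bE cE; ring.
Qed.

Lemma is_normV a b : is_norm a b -> is_norm a b^-1.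
Proof.
move=> nb; have b0 := nb.1; have -> : b^-1 = b * b^-1 ^+ 2 by field.
by apply: is_normM => //; apply: is_norm_sqr; rewrite invr_eq0.
Qed.

Lemma is_normMl a b c : is_norm a b -> is_norm a (b * c) <-> is_norm a c.
Proof.
move=> nb; split; last exact: is_normM.
by move=> nbc; rewrite -(mulKf nb.1 c); apply: is_normM => //; exact: is_normV.
Qed.

Lemma is_norm_sqrMl a c s : s != 0 -> is_norm a (s ^+ 2 * c) <-> is_norm a c.
Proof. by move=> s0; apply: is_normMl; exact: is_norm_sqr. Qed.

Lemma is_norm_opp a : a != 0 -> is_norm a (- a).
Proof.
by split; [rewrite oppr_eq0 | exists 0, 1; rewrite expr0n expr1n mulr1 sub0r].
Qed.

Hypothesis n2 : (2 : k) != 0.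

(** If y is nonzero, c = x^2 - a y^2 can be solved for a. If y = 0, then c is a square and a is the
    difference of the squares of (a + 1)/2 and (a - 1)/2. *)
Lemma is_norm_sym a c : a != 0 -> is_norm a c -> is_norm c a.
Proof.
move=> a0 [c0 [x [y cE]]]; split=> //; have [y0|y0] := eqVneq y 0.
  have x0 : x != 0.
    by apply: contraNneq c0 => x0; rewrite cE x0 y0 expr0n /= mulr0 subr0.
  exists ((a + 1) / 2), ((a - 1) / (2 * x)).
  by rewrite cE y0; field; rewrite x0 n2.
by exists (x / y), y^-1; rewrite cE; field.
Qed.

Lemma is_norm_symE a c : a != 0 -> c != 0 -> is_norm a c <-> is_norm c a.
Proof. by split; exact: is_norm_sym. Qed.

Lemma is_normMr a b c : a != 0 -> b != 0 ->
  is_norm a c -> is_norm b c -> is_norm (a * b) c.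
Proof.
move=> a0 b0 na nb; apply: is_norm_sym; first exact: na.1.
by apply: is_normM; exact: is_norm_sym.
Qed.

End NormGroup.

(** * Successive approximation and lifting from the residue field *)

Section LocalField.
Variables (k : fieldType) (v : k -> int).
Hypothesis dv : discrete_valuation v.
Hypothesis cv : val_complete v.
Hypothesis fv : finite_residue_field v.
Hypothesis n2 : (2 : k) != 0.
Implicit Types (a b c p r s t u x y : k).

Local Notation vg := (val_ge v).

Local Ltac integral := repeat first
  [ assumption | apply: (val_ge0 v) | apply: (val_ge1 dv) | apply: (val_ge_nat dv)
  | apply: (val_geX dv) | apply: (val_geM0 dv) | apply: (val_geB dv)
  | apply: (val_geD dv) | apply: (val_geN dv) ].

Lemma val_onto (m : int) : exists2 c, c != 0 & v c = m.
Proof.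
have [p p0 vp] := val_uniformizer dv.
exists (p ^ m); first exact: expfz_neq0.
case: m => n; first by rewrite -exprnP dvalX // vp mul1r.
by rewrite NegzE -exprnN dvalV ?expf_neq0 // dvalX // vp mul1r.
Qed.

Lemma four_neq0 : (4 : k) != 0.
Proof. by have -> : 4 = 2 * 2 :> k by [ring]; rewrite mulf_neq0. Qed.

Lemma val4 : v 4 = 2 * v 2.
Proof. by have -> : 4 = 2 * 2 :> k by [ring]; rewrite (Defs.valM dv) //; lia. Qed.

(** A solution is a fixed point of t -> x - t^2. On the maximal ideal this map is contracting, since
    the difference of two squares gains the factor t + t', so its iterates from 0 converge. *)
Lemma artin_schreier_hensel x : vg 1 x -> exists2 t, vg 1 t & t ^+ 2 + t = x.
Proof.
move=> hx; pose u n := iter n (fun t => x - t ^+ 2) 0.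
have vg1M N y z : vg N y -> vg 1 z -> vg (N + 1) (y * z) by exact: val_geM.
have u1 n : vg 1 (u n).
  elim: n => [|n IH]; first exact: val_ge0.
  apply: (val_geB dv) => //; apply: (@val_geW _ _ 1 (1 + 1)) => //; exact: vg1M.
have du n : vg n.+1%:Z (u n.+1 - u n).
  elim: n => [|n IH]; first by rewrite subr0; apply: u1.
  have -> : u n.+2 - u n.+1 = - ((u n.+1 - u n) * (u n.+1 + u n)).
    by rewrite /u /=; ring.
  apply: (val_geN dv); rewrite -addn1 PoszD; apply: vg1M => //.
  by apply: (val_geD dv); exact: u1.
have duD n d : vg n.+1%:Z (u (n + d)%N - u n).
  elim: d => [|d IH]; first by rewrite addn0 subrr; exact: val_ge0.
  rewrite addnS -(subrKA (u (n + d)%N)); apply: (val_geD dv) => //.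
  by apply: val_geW (du _); lia.
have [|l ul] := cv (u := u).
  move=> N; exists `|N|%N => m n hm hn; rewrite -(subrKA (u `|N|%N)) -[_ - u n]opprB.
  have h j : (`|N| <= j)%N -> vg N (u j - u `|N|%N).
    by move=> hj; rewrite -(subnKC hj); apply: val_geW (duD _ _); lia.
  by apply: (val_geB dv); exact: h.
have l1 : vg 1 l.
  have [n /(_ n (leqnn n)) h] := ul 1.
  by rewrite -(subKr (u n) l); apply: (val_geB dv) => //; exact: u1.
exists l => //; apply/eqP; rewrite -subr_eq0; apply/negPn/negP => l0.
(* A nonzero defect [d] has a finite valuation; approximating the limit beyond it is
   contradictory. *)
set d := _ - x in l0; set N := v d + 1; have [n h] := ul N.
suff : vg N d by rewrite val_geE // /N; lia.
have -> : d = - ((u n - l) * (u n + l)) - (u n.+1 - l) by rewrite /d /u /=; ring.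
have h0 := h n (leqnn n); have h1 := h n.+1 (leqnSn n).
apply: (val_geB dv) => //; apply: (val_geN dv).
rewrite -[N]addr0; apply: (val_geM dv) => //.
by apply: (@val_geW _ _ 0 1) => //; apply: (val_geD dv).
Qed.

(** Solving t^2 + t = w / x turns 1 + 4 w / x into (1 + 2t)^2. *)
Lemma sqr_near_unit x w : x != 0 -> v x = 0 -> vg 1 w ->
  x + 4 * w != 0 -> exists2 s, s != 0 & x + 4 * w = s ^+ 2 * x.
Proof.
move=> x0 vx hw n0; have [|t _ tE] := @artin_schreier_hensel (w / x).
  by have := val_ge_div dv x0 hw; rewrite vx subr0.
have sE : x + 4 * w = (1 + 2 * t) ^+ 2 * x.
  have -> : (1 + 2 * t) ^+ 2 = 1 + 4 * (t ^+ 2 + t) by ring.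
  by rewrite tE; field.
exists (1 + 2 * t) => //; apply: contraNneq n0 => s0.
by rewrite sE s0 expr0n mul0r.
Qed.

Lemma residue_artin_schreier_missed :
  exists2 rho, vg 0 rho & forall t, vg 0 t -> ~ vg 1 (rho - (t ^+ 2 + t)).
Proof.
have [F [phi [phiD phiM phiN phin [phi0 phi_surj]]]] := residue_field dv fv.
have [a aN] := artin_schreier_missed F; have [rho hrho rhoE] := phi_surj a.
exists rho => // t ht; have h : vg 0 (rho - (t ^+ 2 + t)) by integral.
move=> /(phi0 _ h); rewrite phiD ?phiN ?phiD ?phiM; integral; rewrite rhoE => /eqP.
by rewrite subr_eq0 (negbTE (aN _)).
Qed.

Lemma residue_char2_square u : vg 1 2 -> vg 0 u ->
  exists2 s, vg 0 s & vg 1 (u - s ^+ 2).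
Proof.
have [F [phi [phiD phiM phiN phin [phi0 phi_surj]]]] := residue_field dv fv.
move=> h2 hu; have F2 : (2 : F) = 0.
  by rewrite -(phin 2); apply/phi0 => //; integral.
have [a aE] := char2_square F2 (phi u); have [s hs sE] := phi_surj a.
exists s => //; apply/phi0; first by integral.
by rewrite phiD ?phiN ?phiM; integral; rewrite sE aE subrr.
Qed.

Lemma residue_norm_onto b rho : b != 0 -> v b = 0 -> vg 0 rho ->
  exists x y, [/\ vg 0 x, vg 0 y & vg 1 (rho - (x ^+ 2 + x - b * y ^+ 2))].
Proof.
have [F [phi [phiD phiM phiN phin [phi0 phi_surj]]]] := residue_field dv fv.
move=> b0 vb hrho; have hb : vg 0 b by right; rewrite vb.
have phib : phi b != 0.
  by apply/eqP=> /(phi0 _ hb); rewrite val_geE // vb.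
have [x' [y' e]] := artin_schreier_norm_onto (phi rho) phib.
have [x hx xE] := phi_surj x'; have [y hy yE] := phi_surj y'.
exists x, y; split=> //; apply/phi0; first by integral.
rewrite !(phiD, phiN, phiM); integral.
by rewrite xE yE e subrr.
Qed.

Lemma residue_artin_schreier_index2 u rho : vg 0 u -> vg 0 rho ->
  (forall t, vg 0 t -> ~ vg 1 (u - (t ^+ 2 + t))) ->
  (forall t, vg 0 t -> ~ vg 1 (rho - (t ^+ 2 + t))) ->
  exists2 t, vg 0 t & vg 1 (rho - (u + (t ^+ 2 + t) * (1 + 4 * u))).
Proof.
have [F [phi [phiD phiM phiN phin [phi0 phi_surj]]]] := residue_field dv fv.
move=> hu hrho uN rhoN.
have missed x : vg 0 x -> (forall t, vg 0 t -> ~ vg 1 (x - (t ^+ 2 + t))) ->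
    forall t' : F, phi x != t' ^+ 2 + t'.
  move=> hx xN t'; apply/eqP=> e; have [t ht tE] := phi_surj t'.
  apply: (xN t ht); apply/phi0; first by integral.
  by rewrite !(phiD, phiN, phiM); integral; rewrite tE e subrr.
have [t' e] := artin_schreier_index2 (missed u hu uN) (missed rho hrho rhoN).
have [t ht tE] := phi_surj t'.
exists t => //; move: (val_ge_nat dv 4) (phin 4%N).
move: (4%:R : k) => q hq qE; apply/phi0; first by integral.
rewrite !(phiD, phiN, phiM); integral.
by rewrite qE (phin 1%N) tE e subrr.
Qed.

Lemma parity (m : int) : exists n, m = 2 * n \/ m = 2 * n + 1.
Proof. by exists (m %/ 2)%Z; lia. Qed.

Lemma val_sqr s : s != 0 -> v (s ^+ 2) = 2 * v s.
Proof. by move=> s0; rewrite dvalX // mulrC. Qed.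

(** Norm conditions see [b] only modulo squares, so its valuation may be shifted by any even
    amount. *)
Lemma val_scale b (m : int) : b != 0 ->
  exists c b', [/\ c != 0, b' != 0, b = c ^+ 2 * b' & v b' = v b - 2 * m].
Proof.
move=> b0; have [c c0 vc] := val_onto m.
exists c, (b / c ^+ 2); split=> //.
- by rewrite mulf_neq0 ?invr_eq0 ?expf_neq0.
- by field.
- by rewrite (Defs.valM dv) ?invr_eq0 ?expf_neq0 // dvalV ?expf_neq0 //
    val_sqr // vc.
Qed.

(** In residue characteristic 2 the element is congruent to 1. Otherwise 4 is a unit, and 1 + 4u in
    the maximal ideal would make u congruent to t^2 + t at t = -1/2. *)
Lemma one_plus4_unit u : vg 0 u -> (forall t, vg 0 t -> ~ vg 1 (u - (t ^+ 2 + t))) ->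
  1 + 4 * u != 0 /\ v (1 + 4 * u) = 0.
Proof.
move=> hu uN; apply: val_unit => //; first by integral.
move=> h; have [h2|h2] := pselect (vg 1 2).
  have : vg 1 (1 : k).
    rewrite -[X in vg _ X](addrK (4 * u)); apply: (val_geB dv) => //.
    rewrite -[1]addr0; apply: (val_geM dv) => //.
    have -> : 4 = 2 * 2 :> k by ring.
    by rewrite -[1]addr0; apply: (val_geM dv) => //; integral.
  by rewrite val_geE ?oner_neq0 // dval1.
have [_ v2] : (2 : k) != 0 /\ v 2 = 0 by apply: val_unit => //; integral.
have hV : vg 0 (- 2^-1) by apply: (val_geN dv); right; rewrite dvalV // v2.
apply: (uN _ hV).
have -> : u - ((- 2^-1) ^+ 2 + - 2^-1) = (1 + 4 * u) / 4.
  by field; rewrite n2 four_neq0.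
by have := val_ge_div dv four_neq0 h; rewrite val4 v2 mulr0 subr0.
Qed.

(** * The unramified class of [Delta] and its use for general norm groups *)

Section Unramified.
Variable rho : k.
Hypothesis hrho : vg 0 rho.
Hypothesis rhoN : forall t, vg 0 t -> ~ vg 1 (rho - (t ^+ 2 + t)).

Let Delta := 1 + 4 * rho.

Lemma Delta_neq0 : Delta != 0. Proof. exact: (one_plus4_unit hrho rhoN).1. Qed.

Lemma val_Delta : v Delta = 0. Proof. exact: (one_plus4_unit hrho rhoN).2. Qed.

(** After scaling to a unit b', symmetry asks for [Delta] as a norm for b'. Writing rho as x^2 + x -
    b' y^2 modulo the maximal ideal gives (1 + 2x)^2 - b' (2y)^2 up to 4 times that ideal, an error
    that only changes [Delta] by a square factor. *)
Lemma is_norm_Delta_even b m : b != 0 -> v b = 2 * m -> is_norm Delta b.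
Proof.
move=> b0 vb; have [c [b' [c0 b'0 bE vb']]] := val_scale m b0.
rewrite bE is_norm_sqrMl //; rewrite vb subrr in vb'.
apply: is_norm_sym => //.
have [x [y [hx hy]]] := residue_norm_onto b'0 vb' hrho.
set w := (X in vg 1 X) => hw.
have nE : Delta + 4 * (- w) = (1 + 2 * x) ^+ 2 - b' * (2 * y) ^+ 2.
  by rewrite /Delta /w; ring.
have [n0 vn] : Delta + 4 * (- w) != 0 /\ v (Delta + 4 * (- w)) = v Delta.
  apply: val_dom => //; first exact: Delta_neq0.
  rewrite val_Delta add0r -[1]add0r; apply: (val_geM dv); first by integral.
  exact: val_geN.
have [s s0 sE] := sqr_near_unit Delta_neq0 val_Delta (val_geN dv hw) n0.
by rewrite -(is_norm_sqrMl _ _ s0) -sE; split=> //; exists (1 + 2 * x), (2 * y).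
Qed.

(** With x / y = 1 + 2t the norm is 4 y^2 (t^2 + t - rho). The last factor is a unit for integral t,
    by the choice of [rho], and otherwise has the valuation of t^2. *)
Lemma is_norm_Delta_odd b m : is_norm Delta b -> v b <> 2 * m + 1.
Proof.
move=> [b0 [x [y bE]]]; have [y0|y0] := eqVneq y 0.
  move: bE b0; rewrite y0 expr0n mulr0 subr0 => -> x0.
  by rewrite val_sqr; [lia | apply: contraNneq x0 => ->; rewrite expr0n].
pose t := (x / y - 1) / 2; pose d := t ^+ 2 + t - rho.
have {}bE : b = y ^+ 2 * (4 * d) by rewrite bE /d /t /Delta; field; rewrite n2.
have d0 : d != 0.
  by apply: contraNneq b0 => d0; rewrite bE d0 !mulr0.
have -> : v b = 2 * v y + (2 * v 2 + v d).
  by rewrite bE (Defs.valM dv _ (mulf_neq0 four_neq0 d0)) ?expf_neq0 //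
    (Defs.valM dv four_neq0 d0) val_sqr // val4.
suff [n ->] : exists n, v d = 2 * n by lia.
have [ht|ht] := pselect (vg 0 t).
  exists 0; rewrite mulr0; apply: (val_unit _ _).2; rewrite /d; first by integral.
  by move=> h; apply: (rhoN ht); rewrite -opprB; apply: val_geN.
have t0 : t != 0 by apply/eqP=> t0; apply: ht; rewrite t0; exact: val_ge0.
have vt : v t < 0 by move: ht; rewrite val_geE //; lia.
exists (v t); rewrite -val_sqr // /d -addrA.
apply: (val_dom dv _ _).2; rewrite ?expf_neq0 // val_sqr //.
by apply: (val_geB dv); [right; lia | apply: val_geW hrho; lia].
Qed.

(** If u reduces to some t^2 + t, then 1 + 4u is close to (1 + 2t)^2. If not, the index 2 statement
    in the residue field puts (1 + 2t)^2 (1 + 4u) close to [Delta]. *)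
Lemma unit_sqr_or_Delta u : vg 0 u -> 1 + 4 * u != 0 -> v (1 + 4 * u) = 0 ->
  exists2 s, s != 0 & 1 + 4 * u = s ^+ 2 \/ 1 + 4 * u = s ^+ 2 * Delta.
Proof.
move=> hu u0 vu.
have [uN|] := pselect (forall t, vg 0 t -> ~ vg 1 (u - (t ^+ 2 + t))).
  have [t ht] := residue_artin_schreier_index2 hu hrho uN rhoN.
  set w := (X in vg 1 X) => hw.
  have e : Delta + 4 * (- w) = (1 + 2 * t) ^+ 2 * (1 + 4 * u).
    by rewrite /Delta /w; ring.
  have [n0 _] : Delta + 4 * (- w) != 0 /\ v (Delta + 4 * (- w)) = v Delta.
    apply: val_dom => //; first exact: Delta_neq0.
    rewrite val_Delta add0r -[1]add0r; apply: (val_geM dv); first by integral.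
    exact: val_geN.
  have [s s0 sE] := sqr_near_unit Delta_neq0 val_Delta (val_geN dv hw) n0.
  have t0 : 1 + 2 * t != 0.
    by apply: contraNneq n0 => t0; rewrite e t0 expr0n mul0r.
  exists (s / (1 + 2 * t)); first by rewrite mulf_neq0 ?invr_eq0.
  by right; rewrite exprMn mulrAC -sE e; field.
move=> /existsNP[t /not_implyP[ht /contrapT hw]].
have e : 1 + 4 * u + 4 * - (u - (t ^+ 2 + t)) = (1 + 2 * t) ^+ 2 by ring.
have hw4 : vg 1 (4 * - (u - (t ^+ 2 + t))).
  rewrite -[1]add0r; apply: (val_geM dv); first by integral.
  exact: val_geN.
have [n0 _] : 1 + 4 * u + 4 * - (u - (t ^+ 2 + t)) != 0 /\
    v (1 + 4 * u + 4 * - (u - (t ^+ 2 + t))) = v (1 + 4 * u).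
  by apply: val_dom => //; rewrite vu.
have [s s0 sE] := sqr_near_unit u0 vu (val_geN dv hw) n0.
exists ((1 + 2 * t) / s); last first.
  by left; rewrite exprMn -e sE; field.
rewrite mulf_neq0 ?invr_eq0 //; apply: contraNneq n0 => t0.
by rewrite e t0 expr0n.
Qed.

(* The descent improves the approximation of [b] by [r ^+ 2 + p * t ^+ 2] one
   step of valuation at a time, using [r] in even and [t] in odd valuation; the
   cross terms are harmless up to the valuation of [4].  Only residue
   characteristic 2 needs it. *)
Lemma unit_approx_form p b : p != 0 -> v p = 1 -> b != 0 -> v b = 0 ->
  exists r t u, [/\ vg 0 r, vg 0 t & vg 0 u] /\
    [/\ b = r ^+ 2 + p * t ^+ 2 + 4 * u,
        r ^+ 2 + p * t ^+ 2 != 0 & v (r ^+ 2 + p * t ^+ 2) = 0].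
Proof.
move=> p0 vp b0 vb; have hb : vg 0 b by right; rewrite vb.
have hp : vg 0 p by right; rewrite vp.
have [h2|h2] := pselect (vg 1 2); last first.
  have [_ v2] : (2 : k) != 0 /\ v 2 = 0 by apply: val_unit => //; integral.
  have hb1 : vg 0 (b - 1) by integral.
  have hu : vg 0 ((b - 1) / 4).
    by have := val_ge_div dv four_neq0 hb1; rewrite val4 v2 mulr0 subr0.
  exists 1, 0, ((b - 1) / 4); split; first by split; integral.
  rewrite expr1n expr0n mulr0 addr0 oner_neq0 (dval1 dv); split=> //.
  by field; exact: four_neq0.
have v2 : 0 < v 2 by move: h2; rewrite val_geE //; lia.
have vpn n : v (p ^+ n) = n%:Z by rewrite dvalX // vp mul1r.
have pn0 n : p ^+ n != 0 by rewrite expf_neq0.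
have hpn (n : nat) : vg n (p ^+ n) by right; rewrite vpn.
have div N (n : nat) x : vg N x -> vg (N - n%:Z) (x / p ^+ n).
  by rewrite -(vpn n); exact: val_ge_div.
have vgM N M L x y : vg M x -> vg L y -> N <= M + L -> vg N (x * y).
  by move=> hx hy; move/val_geW; apply; exact: val_geM.
(* The induction stops at m = v 2, where the precision 2m reaches the valuation of 4. *)
have claim (m : nat) : m%:Z <= v 2 -> exists r t, [/\ vg 0 r, vg 0 t &
    vg (2 * m%:Z) (b - (r ^+ 2 + p * t ^+ 2))].
  elim: m => [|m IH] hm.
    exists 0, 0; rewrite expr0n /= !mulr0 addr0 subr0.
    by split=> //; exact: val_ge0.
  have [|r [t [hr ht]]] := IH; first lia.
  set d := (b - _) => hd.
  have hu : vg 0 (d / p ^+ (2 * m)) by apply: val_geW (div _ _ _ hd); lia.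
  have [w hw hw2] := residue_char2_square h2 hu.
  (* [d1] is the error left after adding p^m w to [r]. Its cross term has valuation at least v 2 +
     m, which is at least 2m + 1 because m < v 2. *)
  set d1 := p ^+ (2 * m) * (d / p ^+ (2 * m) - w ^+ 2) - 2 * (p ^+ m * (r * w)).
  have hd1 : vg (2 * m + 1)%N%:Z d1.
    apply: (val_geB dv); first by apply: (vgM _ _ _ _ _ (hpn _) hw2); lia.
    apply: (vgM _ _ (m%:Z + 0) _ _ (val_ge_val v 2)); last by lia.
    by apply: (val_geM dv (hpn _)); integral.
  have hu1 : vg 0 (d1 / p ^+ (2 * m + 1)).
    by apply: val_geW (div _ _ _ hd1); lia.
  have [z hz hz2] := residue_char2_square h2 hu1.
  exists (r + p ^+ m * w), (t + p ^+ m * z); split.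
  - by integral.
  - by integral.
  have -> : b - ((r + p ^+ m * w) ^+ 2 + p * (t + p ^+ m * z) ^+ 2) =
     p ^+ (2 * m + 1) * (d1 / p ^+ (2 * m + 1) - z ^+ 2)
       - 2 * (p ^+ (m + 1) * (t * z)).
    rewrite /d1 /d !addn1 !exprSr mulnC exprM.
    by field; rewrite p0 expf_neq0.
  apply: (val_geB dv); first by apply: (vgM _ _ _ _ _ (hpn _) hz2); lia.
  apply: (vgM _ _ ((m + 1)%N%:Z + 0) _ _ (val_ge_val v 2)); last by lia.
  by apply: (val_geM dv (hpn _)); integral.
have [|r [t [hr ht hd]]] := claim `|v 2|%N; first by rewrite gez0_abs ?lexx ?ltW.
rewrite gez0_abs ?ltW // in hd; set n := r ^+ 2 + _ in hd *.
have hu : vg 0 ((b - n) / 4).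
  by have := val_ge_div dv four_neq0 hd; rewrite val4; apply: val_geW; lia.
exists r, t, ((b - n) / 4); split=> //; rewrite -/n.
have [n0 vn] : b + - (b - n) != 0 /\ v (b + - (b - n)) = v b.
  by apply: val_dom => //; apply: (val_geN dv); apply: val_geW hd; lia.
rewrite subKr in n0 vn; split=> //; last by rewrite vn.
by field; exact: four_neq0.
Qed.

(** For a unit c', write a = f^2 p with p of valuation 1. Approximating c' by q = r^2 - p t^2, a
    norm for a, leaves c' / q of the form 1 + 4u, hence a square or [Delta] times a square. Odd
    valuations are reduced to even ones by the norm -a. *)
Lemma odd_norm_Delta_cover a b m : a != 0 -> v a = 2 * m + 1 -> b != 0 ->
  is_norm a b \/ is_norm a (Delta * b).
Proof.
move=> a0 va.
have even c n : c != 0 -> v c = 2 * n -> is_norm a c \/ is_norm a (Delta * c).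
  move=> c0 vc; have [e [c' [e0 c'0 eE vc']]] := val_scale n c0.
  have {}vc' : v c' = 0 by rewrite vc' vc subrr.
  rewrite eE mulrCA !is_norm_sqrMl //.
  have [f [p [f0 p0 aE vp]]] := val_scale m a0.
  have {}vp : v (- p) = 1 by rewrite dvalN // vp va; lia.
  have [|r [t [u [[hr ht hu] [cE n0 vn]]]]] := unit_approx_form _ vp c'0 vc'.
    by rewrite oppr_eq0.
  set q := r ^+ 2 + _ in cE n0 vn.
  have nq : is_norm a q by split=> //; exists r, (t / f); rewrite aE /q; field.
  have uE : 1 + 4 * (u / q) = c' / q by rewrite cE; field.
  have hun : vg 0 (u / q) by have := val_ge_div dv n0 hu; rewrite vn subr0.
  have [] := unit_sqr_or_Delta hun; rewrite ?uE.
  - by rewrite mulf_neq0 ?invr_eq0.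
  - by rewrite (Defs.valM dv) ?invr_eq0 // dvalV // vn vc'.
  move=> s s0 [] sE; [left | right].
    by rewrite -(divfK n0 c') sE is_norm_sqrMl.
  have -> : Delta * c' = Delta ^+ 2 * (s ^+ 2 * q).
    by rewrite -(divfK n0 c') sE; ring.
  by rewrite !is_norm_sqrMl ?Delta_neq0.
move=> b0; have [n [vb|vb]] := parity (v b); first exact: even vb.
have na := is_norm_opp a0; rewrite -(is_normMl b na) -(is_normMl (Delta * b) na).
rewrite mulrCA; apply: (even _ (m + n + 1)); first by rewrite mulf_neq0 ?oppr_eq0.
by rewrite (Defs.valM dv) ?oppr_eq0 // dvalN // va vb; lia.
Qed.

Lemma odd_norm_DeltaN a m : a != 0 -> v a = 2 * m + 1 -> ~ is_norm a Delta.
Proof. by move=> a0 va /(is_norm_sym n2 a0)/(is_norm_Delta_odd (m := m)). Qed.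

(** For odd valuation -a serves. For a unit a' = r^2 + p t^2 + 4u, either p t^2 dominates 4u and r^2
    - a' has odd valuation, or a' / r^2 has the form 1 + 4u' and lies in an excluded class. *)
Lemma odd_norm_exists a : a != 0 ->
  (forall s, a <> s ^+ 2) -> (forall s, a <> s ^+ 2 * Delta) ->
  exists b m, is_norm a b /\ v b = 2 * m + 1.
Proof.
move=> a0 asq aD; have [m [va|va]] := parity (v a); last first.
  by exists (- a), m; rewrite dvalN //; split=> //; exact: is_norm_opp.
have [c [a' [c0 a'0 aE va']]] := val_scale m a0.
have {}va' : v a' = 0 by rewrite va' va subrr.
have [p p0 vp] := val_uniformizer dv.
have [r [t [u [[hr ht hu] [a'E n0 vn]]]]] := unit_approx_form p0 vp a'0 va'.
set n := r ^+ 2 + _ in n0 vn.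
have [vt|vt] := pselect (t != 0 /\ 1 + 2 * v t < 2 * v 2).
  have [t0 vt2] := vt.
  have pt0 : p * t ^+ 2 != 0 by rewrite mulf_neq0 ?expf_neq0.
  have vpt : v (p * t ^+ 2) = 1 + 2 * v t.
    by rewrite (Defs.valM dv) ?expf_neq0 // val_sqr // vp.
  have [d0 vd] : p * t ^+ 2 + 4 * u != 0 /\ v (p * t ^+ 2 + 4 * u) = v (p * t ^+ 2).
    apply: val_dom => //; apply: (@val_geW _ _ _ (v 4 + 0)).
      by rewrite vpt val4; lia.
    by apply: (val_geM dv) => //; exact: val_ge_val.
  exists (- (p * t ^+ 2 + 4 * u)), (v t); rewrite dvalN // vd vpt.
  split; last by lia.
  split; first by rewrite oppr_eq0.
  by exists r, c^-1; rewrite aE a'E; field.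
have h4 : vg (v 4) (p * t ^+ 2).
  have [->|t0] := eqVneq t 0; first by rewrite expr0n mulr0; left.
  right; rewrite (Defs.valM dv) ?expf_neq0 // val_sqr // vp val4.
  by rewrite leNgt; apply/negP=> h; apply: vt.
have hu' : vg 0 (p * t ^+ 2 / 4 + u).
  by apply: (val_geD dv) => //; have := val_ge_div dv four_neq0 h4; rewrite subrr.
have {}a'E : a' = r ^+ 2 + 4 * (p * t ^+ 2 / 4 + u).
  by rewrite a'E; field; exact: four_neq0.
have [r20 vr2] : n + - (p * t ^+ 2) != 0 /\ v (n + - (p * t ^+ 2)) = v n.
  apply: val_dom => //; apply: (val_geN dv); rewrite vn add0r -[1]addr0 -{1}vp.
  by apply: (val_geM dv); [exact: val_ge_val | integral].
rewrite addrK in r20 vr2; rewrite vn in vr2.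
have r0 : r != 0 by apply: contraNneq r20 => ->; rewrite expr0n.
set u' := _ + u in hu' a'E.
have hur : vg 0 (u' / r ^+ 2) by have := val_ge_div dv r20 hu'; rewrite vr2 subr0.
have uE : 1 + 4 * (u' / r ^+ 2) = a' / r ^+ 2 by rewrite a'E; field.
have [] := unit_sqr_or_Delta hur; rewrite ?uE.
- by rewrite mulf_neq0 ?invr_eq0.
- by rewrite (Defs.valM dv) ?invr_eq0 // dvalV // vr2 va'.
move=> s s0 []; last first.
  move=> sE; case: (aD (c * r * s)).
  by rewrite aE -(divfK r20 a') sE; ring.
move=> sE; case: (asq (c * r * s)).
by rewrite aE -(divfK r20 a') sE; ring.
Qed.

(** In the class of [Delta], non-norms have odd valuation and their product an even one. Otherwise a
    norm of odd valuation lets [b] and [c] be made odd; then each is a norm for Delta a by the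
    covering lemma and symmetry. Their product is a norm for Delta a and, having even valuation, for
    [Delta], hence for [a]. *)
Lemma norm_index2 a b c : a != 0 -> b != 0 -> c != 0 ->
  ~ is_norm a b -> ~ is_norm a c -> is_norm a (b * c).
Proof.
move=> a0 b0 c0 nb nc.
have D0 := Delta_neq0.
have [[s aE]|aD] := pselect (exists s, a = s ^+ 2 * Delta).
  have s0 : s != 0 by apply: contraNneq a0 => s0; rewrite aE s0 expr0n mul0r.
  have nE x : x != 0 -> is_norm a x <-> is_norm Delta x.
    by move=> x0; rewrite !(is_norm_symE n2 _ x0) // aE is_norm_sqrMl.
  apply/nE; first by rewrite mulf_neq0.
  have odd x : x != 0 -> ~ is_norm a x -> exists m, v x = 2 * m + 1.
    move=> x0 nx; have [m [vx|vx]] := parity (v x); last by exists m.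
    by case: nx; apply/nE => //; exact: is_norm_Delta_even vx.
  have [m vb] := odd b b0 nb; have [n vc] := odd c c0 nc.
  apply: (@is_norm_Delta_even _ (m + n + 1)); first by rewrite mulf_neq0.
  by rewrite (Defs.valM dv) // vb vc; lia.
have asq s : a <> s ^+ 2.
  move=> aE; have s0 : s != 0 by apply: contraNneq a0 => s0; rewrite aE s0 expr0n.
  apply: nb; apply: is_norm_sym => //; rewrite aE; exact: is_norm_sqr.
have [|p [m [np vp]]] := odd_norm_exists a0 asq.
  by move=> s aE; apply: aD; exists s.
have to_odd x : x != 0 -> ~ is_norm a x -> exists x' n,
    [/\ x' != 0, ~ is_norm a x', v x' = 2 * n + 1 &
       forall y, is_norm a (x' * y) <-> is_norm a (x * y)].
  move=> x0 nx; have [n [vx|vx]] := parity (v x); last by exists x, n.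
  exists (p * x), (m + n); split.
  - by rewrite mulf_neq0 // np.1.
  - by rewrite is_normMl.
  - by rewrite (Defs.valM dv) ?np.1 // vp vx; lia.
  - by move=> y; rewrite -mulrA is_normMl.
have [b' [i [b'0 nb' vb' bE]]] := to_odd b b0 nb.
have [c' [j [c'0 nc' vc' cE]]] := to_odd c c0 nc.
rewrite -bE mulrC -cE.
have nD x n : x != 0 -> ~ is_norm a x -> v x = 2 * n + 1 -> is_norm (Delta * a) x.
  move=> x0 nx vx; apply: is_norm_sym => //.
  have [h|//] := odd_norm_Delta_cover x0 vx a0.
  by case: nx; apply: is_norm_sym.
have nD2 : is_norm Delta (c' * b').
  apply: (@is_norm_Delta_even _ (i + j + 1)); first by rewrite mulf_neq0.
  by rewrite (Defs.valM dv) // vb' vc'; lia.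
have nDa : is_norm (Delta * a) (c' * b').
  by apply: is_normM; [exact: nD vc' | exact: nD vb'].
have cb0 : c' * b' != 0 by rewrite mulf_neq0.
apply: is_norm_sym => //; rewrite -(is_normMl (b := Delta)).
  by apply: is_norm_sym; rewrite ?mulf_neq0.
exact: is_norm_sym.
Qed.

(** Outside the class of [Delta], take a norm p of odd valuation for Delta a. Were p also a norm for
    [a], then [Delta] would be a norm for p, contradicting parity. *)
Lemma norm_proper a : a != 0 -> (forall s, a <> s ^+ 2) ->
  exists2 b, b != 0 & ~ is_norm a b.
Proof.
move=> a0 asq; have D0 := Delta_neq0.
have [[s aE]|aD] := pselect (exists s, a = s ^+ 2 * Delta).
  have s0 : s != 0 by apply: contraNneq a0 => s0; rewrite aE s0 expr0n mul0r.
  have [p p0 vp] := val_uniformizer dv; exists p => //.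
  move=> /(is_norm_sym n2 a0); rewrite aE is_norm_sqrMl //.
  by move=> /(is_norm_sym n2 p0)/(is_norm_Delta_odd (m := 0)); rewrite vp.
have Da0 : Delta * a != 0 by rewrite mulf_neq0.
have [||p [m [np vp]]] := odd_norm_exists Da0.
- move=> s sE; apply: aD; exists (s / Delta).
  by rewrite exprMn mulrAC -sE; field.
- by move=> s; rewrite mulrC => /(mulIf D0); exact: asq.
have p0 := np.1; exists p => // /(is_norm_sym n2 a0) npa.
apply: (odd_norm_DeltaN p0 vp); move: (is_norm_sym n2 Da0 np).
by rewrite mulrC is_normMl.
Qed.


End Unramified.

(** * Index and inclusion of norm groups *)

Lemma norm_subgroup_index2 a b c : a != 0 -> b != 0 -> c != 0 ->
  ~ is_norm a b -> ~ is_norm a c -> is_norm a (b * c).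
Proof.
have [rho hrho rhoN] := residue_artin_schreier_missed.
exact: norm_index2 hrho rhoN _ _ _.
Qed.

Lemma norm_subgroup_proper a : a != 0 -> (forall s, a <> s ^+ 2) ->
  exists2 b, b != 0 & ~ is_norm a b.
Proof.
have [rho hrho rhoN] := residue_artin_schreier_missed.
exact: norm_proper hrho rhoN _.
Qed.

(** If a d were not a square, some c would not be a norm for it. By inclusion c is not a norm for d,
    and index 2 for d then rules out that it is one for a. So neither a nor d is a norm for c, and
    index 2 for c makes a d one. *)
Lemma norm_subgroup_incl a d : a != 0 -> d != 0 ->
  (forall s, a <> s ^+ 2) -> (forall s, d <> s ^+ 2) ->
  (forall c, is_norm d c -> is_norm a c) -> exists s, a * d = s ^+ 2.
Proof.
move=> a0 d0 asq dsq incl; apply/not_existsP => adsq.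
have ad0 : a * d != 0 by rewrite mulf_neq0.
have [c c0 []] := norm_subgroup_proper ad0 adsq.
have [nd|nd] := pselect (is_norm d c); first exact: is_normMr (incl c nd) nd.
have na : ~ is_norm a c.
  move=> na; have [e e0 ne] := norm_subgroup_proper a0 asq.
  have nde : ~ is_norm d e by move/incl.
  have := incl _ (norm_subgroup_index2 d0 e0 c0 nde nd).
  by rewrite mulrC is_normMl.
apply: is_norm_sym => //; apply: norm_subgroup_index2 => //.
  by move=> h; apply: na; apply: is_norm_sym.
by move=> h; apply: nd; apply: is_norm_sym.
Qed.

End LocalField.

(** * Orbits *)

Section Orbits.
Variable k : fieldType.
Implicit Types (a c x y z t : k) (u w : 'rV[k]_3) (g h : 'M[k]_2).

Lemma vec3_00 x y z : vec3 x y z 0 0 = x. Proof. by rewrite mxE. Qed.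
Lemma vec3_01 x y z : vec3 x y z 0 1 = y. Proof. by rewrite mxE. Qed.
Lemma vec3_02 x y z : vec3 x y z 0 2 = z. Proof. by rewrite mxE. Qed.

Lemma scale_vec3 c x y z : c *: vec3 x y z = vec3 (c * x) (c * y) (c * z).
Proof. by apply/rowP=> i; rewrite !mxE; case: i => [[|[|[|//]]] ?]. Qed.

Lemma sym2Z c u : sym2 (c *: u) = c *: sym2 u.
Proof.
by apply/matrixP=> -[[|[|//]] ?] [[|[|//]] ?]; rewrite !mxE.
Qed.

Lemma sym2_inj : injective (@sym2 k).
Proof.
move=> u w e; rewrite (vec3E u) (vec3E w).
have ij i j := congr1 (fun S : 'M[k]_2 => S i j) e.
by have := ij 0 0; have := ij 0 1; have := ij 1 1; rewrite !mxE /= => -> -> ->.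
Qed.

Lemma AdM g h u : \det g = 1 -> \det h = 1 -> Ad (g *m h) u = Ad g (Ad h u).
Proof.
move=> dg dh; apply: sym2_inj.
by rewrite !sym2_Ad det_mulmx dg dh mulr1 invr1 !scale1r trmx_mul !mulmxA.
Qed.

Lemma AdZr g c u : Ad g (c *: u) = c *: Ad g u.
Proof.
apply: sym2_inj; rewrite sym2Z !sym2_Ad sym2Z.
by rewrite -scalemxAr -scalemxAl !scalerA mulrC.
Qed.

Lemma det2 g : \det g = g 0 0 * g 1 1 - g 0 1 * g 1 0.
Proof.
rewrite (expand_det_row _ 0) !big_ord_recl big_ord0 /cofactor !det_mx11 !mxE /=.
rewrite addr0 expr0 expr1 mul1r mulN1r mulrN.
by congr (_ * g _ _ - g _ _ * g _ _); apply: val_inj.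
Qed.

Lemma Ad_valpha g a : \det g = 1 ->
  Ad g (valpha a) = vec3 (a * g 0 0 ^+ 2 + g 0 1 ^+ 2)
    (a * g 0 0 * g 1 0 + g 0 1 * g 1 1) (a * g 1 0 ^+ 2 + g 1 1 ^+ 2).
Proof.
move=> dg; rewrite /Ad dg invr1 scale1r /unsym2.
rewrite !mxE !big_ord_recl !big_ord0 !mxE !big_ord_recl !big_ord0 !mxE /=.
have e : lift 0 0 = 1 :> 'I_2 by exact: val_inj.
by rewrite e; congr vec3; ring.
Qed.

Lemma orbit_valphaP (abar : set k) a w :
  orbit_of (KAdPSL2 abar) (valpha a) w <->
  exists c x y z t, [/\ Kgroup abar c, x * t - y * z = 1 &
    w = c *: vec3 (a * x ^+ 2 + y ^+ 2) (a * x * z + y * t) (a * z ^+ 2 + t ^+ 2)].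
Proof.
split=> [[_ [c Kc [_ [g dg <-] <-]] <-]|[c [x [y [z [t [Kc d ->]]]]]]].
  exists c, (g 0 0), (g 0 1), (g 1 0), (g 1 1); rewrite -det2 dg; split=> //.
  by rewrite Ad_valpha.
pose g : 'M[k]_2 := \matrix_(i, j) (nth [::] [:: [:: x; y]; [:: z; t]] i)`_j.
have dg : \det g = 1 by rewrite det2 !mxE.
exists (fun u => c *: Ad g u).
  by exists c => //; exists (Ad g) => //; exists g.
by rewrite Ad_valpha // !mxE.
Qed.

Lemma orbit_trans (abar : set k) u w :
  (forall b c, Kgroup abar b -> Kgroup abar c -> Kgroup abar (b * c)) ->
  orbit_of (KAdPSL2 abar) u w ->
  orbit_of (KAdPSL2 abar) w `<=` orbit_of (KAdPSL2 abar) u.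
Proof.
move=> KM [_ [c Kc [_ [g dg <-] <-]] <-] _ [_ [b Kb [_ [h dh <-] <-]] <-].
exists (fun u => (b * c) *: Ad (h *m g) u); last first.
  by rewrite AdM // AdZr scalerA.
exists (b * c); first exact: KM.
by exists (Ad (h *m g)) => //; exists (h *m g) => //=; rewrite det_mulmx dh dg mulr1.
Qed.

(** The middle coordinate is s t up to sign, and the sign is absorbed in t. *)
Lemma cone1P w : cone1 w ->
  exists s t, ~ (s = 0 /\ t = 0) /\ w = vec3 (s ^+ 2) (s * t) (t ^+ 2).
Proof.
case=> w0 [A [b [C [wE e [s As] [t Ct]]]]].
have nz : ~ (s = 0 /\ t = 0).
  case=> s0 t0; move: e; rewrite As s0 expr0n mul0r => /esym/eqP.
  rewrite sqrf_eq0 => /eqP b0; case/eqP: w0.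
  rewrite wE As Ct s0 t0 b0 expr0n /=.
  by apply/rowP=> i; rewrite !mxE; case: i => [[|[|[|//]]] ?].
have : b ^+ 2 == (s * t) ^+ 2 by rewrite -e As Ct exprMn.
rewrite eqf_sqr => /orP[] /eqP bE; [exists s, t | exists s, (- t)].
  by rewrite -bE -As -Ct.
rewrite mulrN -bE sqrrN -As -Ct; split=> // -[s0 /eqP].
by rewrite oppr_eq0 => /eqP t0; apply: nz.
Qed.

Lemma cone1_sqr s t : ~ (s = 0 /\ t = 0) ->
  cone1 (vec3 (s ^+ 2) (s * t) (t ^+ 2)).
Proof.
move=> nz; split; last first.
  exists (s ^+ 2), (s * t), (t ^+ 2); split=> //; first by rewrite exprMn.
  - by exists s.
  - by exists t.
apply/eqP=> e; apply: nz; split; apply/eqP; rewrite -sqrf_eq0.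
  by rewrite -(vec3_00 (s ^+ 2) (s * t) (t ^+ 2)) e mxE.
by rewrite -(vec3_02 (s ^+ 2) (s * t) (t ^+ 2)) e mxE.
Qed.

(** Determinant 1 preserves Q, so Q detects the homothety factor up to sign; this separates the
    orbits. *)
Lemma qform_orbit (abar : set k) a w : orbit_of (KAdPSL2 abar) (valpha a) w ->
  exists2 c, Kgroup abar c & qform w = c ^+ 2 * a.
Proof.
move=> /orbit_valphaP[c [x [y [z [t [Kc d ->]]]]]]; exists c => //.
rewrite /qform scale_vec3 vec3_00 vec3_01 vec3_02.
by rewrite -[a in RHS]mulr1 -(expr1n _ 2) -d; ring.
Qed.

End Orbits.

(** * The set H and its decomposition into orbits *)

Section LocalField.
Variable k : fieldType.
Hypothesis hk : nonarch_local_field k.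
Hypothesis n2 : (2 : k) != 0.
Variables (abar : set k) (alpha : k).
Hypothesis habar : square_class abar.
Hypothesis halpha : abar alpha.
Hypothesis hN1 : ~ abar (-1).
Implicit Types (a c s t x y z : k) (w : 'rV[k]_3).

Local Notation K := (Kgroup abar).

Lemma square_class_neq0 a : abar a -> a != 0.
Proof. by case: habar => b b0 -> [t /= t0 <-]; rewrite mulf_neq0 ?expf_neq0. Qed.

Lemma square_classP a : abar a <-> exists2 s, s != 0 & a = alpha * s ^+ 2.
Proof.
move: halpha; case: habar => b b0 -> [t /= t0 <-].
split=> [[r /= r0 <-]|[s s0 ->]].
  by exists (r / t); [rewrite mulf_neq0 ?invr_eq0 | field].
by exists (t * s); [rewrite /= mulf_neq0 | ring].
Qed.

Let alpha0 : alpha != 0 := square_class_neq0 halpha.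

(** The hypothesis on -1 enters here: it makes x^2 + alpha y^2 anisotropic. *)
Lemma Nalpha_nonsquare s : - alpha <> s ^+ 2.
Proof.
move=> e; apply: hN1; apply/square_classP.
have s0 : s != 0.
  by apply: contraNneq alpha0 => s0; rewrite -oppr_eq0 e s0 expr0n.
exists s^-1; first by rewrite invr_eq0.
by rewrite -[alpha]opprK e; field.
Qed.

Lemma norm_form_neq0 x y : ~ (x = 0 /\ y = 0) -> x ^+ 2 + alpha * y ^+ 2 != 0.
Proof.
move=> nz; apply/eqP=> e; have [y0|y0] := eqVneq y 0.
  move/eqP: e; rewrite y0 expr0n mulr0 addr0 sqrf_eq0 => /eqP x0; exact: nz.
apply: (@Nalpha_nonsquare (x / y)).
have -> : - alpha = (x ^+ 2 - (x ^+ 2 + alpha * y ^+ 2)) / y ^+ 2 by field.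
by rewrite e subr0 expr_div_n.
Qed.

(* The definition of [Kgroup] asks for nonzero coordinates.  A point of
   [alpha * X ^+ 2 + Y ^+ 2 = 1] with both coordinates nonzero makes up for it. *)
Lemma unit_conic_point :
  exists X Y, [/\ X != 0, Y != 0 & alpha * X ^+ 2 + Y ^+ 2 = 1].
Proof.
have [v [dv _ _]] := hk.
have [t t0 nt] : exists2 t, t != 0 & alpha * t ^+ 2 != 1.
  have [m vm] : exists m : int, v alpha + 2 * m <> 0.
    by have [e|ne] := eqVneq (v alpha) 0; [exists 1; lia | exists 0; lia].
  have [t t0 vt] := val_onto dv m; exists t => //; apply/eqP=> e; apply: vm.
  rewrite -(dval1 dv) -e (Defs.valM dv) ?expf_neq0 //.
  by rewrite (val_sqr dv) // vt.
have n1 : 1 + alpha * t ^+ 2 != 0.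
  rewrite -[1](expr1n _ 2); apply: norm_form_neq0 => -[e _].
  by move/eqP: e; rewrite oner_eq0.
(* Rational parametrisation of the conic; t nonzero and alpha t^2 different from 1 keep both
   coordinates nonzero. *)
exists (2 * t / (1 + alpha * t ^+ 2)), ((1 - alpha * t ^+ 2) / (1 + alpha * t ^+ 2)).
split; last by field.
  by rewrite !mulf_neq0 ?invr_eq0.
by rewrite mulf_neq0 ?invr_eq0 // subr_eq0 eq_sym.
Qed.

Lemma Kgroup_norm c : K c <-> is_norm (- alpha) c.
Proof.
rewrite (KgroupE habar halpha); split=> [[c0 [x [y [x0 y0 cE]]]]|[c0 [x [y cE]]]].
  by split=> //; exists y, x; rewrite cE; ring.
split=> //; have [X [Y [X0 Y0 e]]] := unit_conic_point.
(* When one coordinate vanishes, the value is multiplied by 1 = alpha X^2 + Y^2 and regrouped. *)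
have [y0|y0] := eqVneq y 0; last have [x0|x0] := eqVneq x 0.
- have x0 : x != 0.
    by apply: contraNneq c0 => x0; rewrite cE x0 y0 expr0n /= mulr0 subr0.
  exists (x * X), (x * Y); split; rewrite ?mulf_neq0 //.
  have -> : c = x ^+ 2 * 1 by rewrite cE y0; ring.
  by rewrite -e; ring.
- exists (y * Y), (alpha * y * X); split; rewrite ?mulf_neq0 //.
  have -> : c = alpha * y ^+ 2 * 1 by rewrite cE x0; ring.
  by rewrite -e; ring.
- by exists y, x; split=> //; rewrite cE; ring.
Qed.

Lemma KgroupM b c : K b -> K c -> K (b * c).
Proof. by rewrite !Kgroup_norm; exact: is_normM. Qed.

Lemma Kgroup_index2 b c : b != 0 -> c != 0 -> ~ K b -> ~ K c -> K (b * c).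
Proof.
have [v [dv cv fv]] := hk.
rewrite !Kgroup_norm; apply: (norm_subgroup_index2 dv cv fv n2).
by rewrite oppr_eq0.
Qed.

Lemma Kgroup_proper : exists2 u, u != 0 & ~ K u.
Proof.
have [v [dv cv fv]] := hk.
have [|u u0 nu] := norm_subgroup_proper dv cv fv n2 _ Nalpha_nonsquare.
  by rewrite oppr_eq0.
by exists u => //; rewrite Kgroup_norm.
Qed.

Lemma Kgroup_sqr s : s != 0 -> K (s ^+ 2).
Proof. by move=> s0; rewrite Kgroup_norm; exact: is_norm_sqr. Qed.

Lemma KgroupMl b c : K b -> K (b * c) -> K c.
Proof. by rewrite !Kgroup_norm => nb; rewrite is_normMl. Qed.

Lemma bform_sqr w s t : bform w (vec3 (s ^+ 2) (s * t) (t ^+ 2)) =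
  w 0 0 * t ^+ 2 + w 0 2 * s ^+ 2 - 2 * w 0 1 * (s * t).
Proof.
rewrite bformE; last by rewrite inE.
by rewrite vec3_00 vec3_01 vec3_02.
Qed.

(** The pairing with (p^2, p q, q^2) is c times the anisotropic norm form at (X, Y). Since (X, Y) is
    an invertible linear image of (p, q), the value is nonzero. *)
Lemma orbit_sub_Hset : orbit_of (KAdPSL2 abar) (valpha alpha) `<=` Hset abar.
Proof.
move=> w /orbit_valphaP[c [x [y [z [t [Kc d wE]]]]]] _ /cone1P[p [q [nz ->]]].
rewrite bform_sqr wE scale_vec3 vec3_00 vec3_01 vec3_02.
pose X := y * q - t * p; pose Y := x * q - z * p.
have -> : c * (alpha * x ^+ 2 + y ^+ 2) * q ^+ 2 +
    c * (alpha * z ^+ 2 + t ^+ 2) * p ^+ 2 -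
    2 * (c * (alpha * x * z + y * t)) * (p * q) = c * (X ^+ 2 + alpha * Y ^+ 2).
  by rewrite /X /Y; ring.
apply: KgroupM => //; apply/Kgroup_norm.
split; last by exists X, Y; rewrite mulNr opprK.
apply: norm_form_neq0 => -[X0 Y0]; apply: nz.
have pE : p = y * Y - x * X by rewrite -[p in LHS]mulr1 -d /X /Y; ring.
have qE : q = t * Y - z * X by rewrite -[q in LHS]mulr1 -d /X /Y; ring.
by rewrite pE qE X0 Y0 !mulr0 subrr.
Qed.

(* Completing the square in [s |-> bform w (s ^+ 2, s * t, t ^+ 2)] exhibits [w]
   as a unipotent translate of a multiple of [valpha a]; the norms for [- a] are
   then norms for [- alpha], so that [a] lies in the class of [alpha]. *)
Lemma Hset_sub_orbits w : Hset abar w ->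
  exists2 a, abar a & orbit_of (KAdPSL2 abar) (valpha a) w.
Proof.
move=> Hw; have [v [dv cv fv]] := hk.
have KB s t : ~ (s = 0 /\ t = 0) ->
    K (w 0 0 * t ^+ 2 + w 0 2 * s ^+ 2 - 2 * w 0 1 * (s * t)).
  by move=> nz; rewrite -bform_sqr; apply: Hw; exact: cone1_sqr.
have KZ : K (w 0 2).
  have := KB 1 0; rewrite expr0n expr1n !mulr0 add0r mulr1 subr0; apply.
  by case=> /eqP; rewrite oner_eq0.
have Z0 : w 0 2 != 0 by case: KZ.
pose y := w 0 1 / w 0 2; pose a := w 0 0 / w 0 2 - y ^+ 2.
have norm_val p q : ~ (p = 0 /\ q = 0) -> K (p ^+ 2 + a * q ^+ 2).
  move=> nz; apply: (KgroupMl KZ).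
  have -> : w 0 2 * (p ^+ 2 + a * q ^+ 2) =
      w 0 0 * q ^+ 2 + w 0 2 * (p + y * q) ^+ 2 - 2 * w 0 1 * ((p + y * q) * q).
    by rewrite /a /y; field.
  by apply: KB => -[e q0]; apply: nz; move: e; rewrite q0 mulr0 addr0.
have asq s : - a <> s ^+ 2.
  move=> e; have [|] := norm_val s 1; last by rewrite -e expr1n mulr1 addNr eqxx.
  by case=> _ /eqP; rewrite oner_eq0.
have Na0 : - a != 0 by apply/eqP=> a0; apply: (asq 0); rewrite a0 expr0n.
(* Every norm for -a lies in [K], the norm group of -alpha; the inclusion lemma then makes alpha a a
   square. *)
have [||s aE] := norm_subgroup_incl dv cv fv n2 _ Na0 Nalpha_nonsquare asq.
- by rewrite oppr_eq0.
- move=> c [c0 [p [q cE]]]; apply/Kgroup_norm.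
  rewrite cE mulNr opprK; apply: norm_val => -[p0 q0].
  by move/eqP: c0; rewrite cE p0 q0 expr0n /= mulr0 subr0.
rewrite mulrNN in aE; exists a.
  apply/square_classP; exists (s / alpha); last first.
    by rewrite expr_div_n -aE; field.
  have s0 : s != 0.
    by rewrite -sqrf_eq0 -aE mulf_neq0 // -oppr_eq0.
  by rewrite mulf_neq0 ?invr_eq0.
apply/orbit_valphaP; exists (w 0 2), 1, y, 0, 1; split=> //; first by ring.
rewrite [LHS]vec3E scale_vec3 /a /y; congr vec3; by field.
Qed.

(** With 1/t = y^2 + alpha x^2, the matrix of rows (y, -alpha x) and (x, y) scales the form
    diag(alpha, 1) by 1/t. Composing with diag(t, 1) gives determinant 1 and sends alpha to alpha
    t^2, and the homothety t removes the factor 1/t. *)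
Lemma orbit_rescale t : K t ->
  orbit_of (KAdPSL2 abar) (valpha (alpha * t ^+ 2)) `<=`
  orbit_of (KAdPSL2 abar) (valpha alpha).
Proof.
move=> Kt; apply: orbit_trans; first exact: KgroupM.
apply/orbit_valphaP; have t0 : t != 0 by case: Kt.
have /Kgroup_norm[_ [y [x]]] : K t^-1.
  by apply/Kgroup_norm/is_normV/Kgroup_norm.
rewrite mulNr opprK => tE.
exists t, (t * y), (- (t * alpha * x)), x, y; split=> //.
  have -> : t * y * y - - (t * alpha * x) * x = t * (y ^+ 2 + alpha * x ^+ 2).
    by ring.
  by rewrite -tE mulfV.
rewrite scale_vec3 /valpha; congr vec3; last first.
- by rewrite addrC -tE mulfV.
- by ring.
have -> : t * (alpha * (t * y) ^+ 2 + (- (t * alpha * x)) ^+ 2) =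
  alpha * t ^+ 3 * (y ^+ 2 + alpha * x ^+ 2) by ring.
by rewrite -tE; field.
Qed.

End LocalField.

Theorem theorem2p2 (k : fieldType) (hk : nonarch_local_field k)
  (hchar : 2%N \notin [pchar k]) (abar : set k) (habar : square_class abar)
  (hN1 : ~ abar (-1)) :
  [/\ \bigcup_(a in abar) orbit_of (KAdPSL2 abar) (valpha a) = Hset abar,
      Kgroup abar (-1) ->
        exists v1 v2 : 'rV[k]_3,
          orbit_of (KAdPSL2 abar) v1 `&` orbit_of (KAdPSL2 abar) v2 = set0 /\
          Hset abar =
            orbit_of (KAdPSL2 abar) v1 `|` orbit_of (KAdPSL2 abar) v2
    & ~ Kgroup abar (-1) ->
        exists v : 'rV[k]_3, Hset abar = orbit_of (KAdPSL2 abar) v].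
Proof.
have n2 : (2 : k) != 0 by move: hchar; rewrite inE.
have [alpha halpha] : exists alpha, abar alpha.
  by have [b b0 ->] := habar; exists (b * 1 ^+ 2), 1; rewrite //= oner_neq0.
have alpha0 := square_class_neq0 habar halpha.
have N10 : (-1 : k) != 0 by rewrite oppr_eq0 oner_neq0.
have sub a : abar a -> orbit_of (KAdPSL2 abar) (valpha a) `<=` Hset abar.
  by move=> ha; exact: (orbit_sub_Hset hk n2 habar ha hN1).
have sup := Hset_sub_orbits hk n2 habar halpha hN1.
have rescale a t (ha : abar a) := orbit_rescale hk n2 habar ha hN1 (t := t).
have KMl := KgroupMl hk n2 habar halpha hN1.
have classP := square_classP habar halpha.
have index2 := Kgroup_index2 hk n2 habar halpha hN1.
split.
- apply/seteqP; split=> [w [a ha]|w /sup[a ha aw]]; first exact: sub.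
  by exists a.
- move=> KN1; have [u u0 nu] := Kgroup_proper hk n2 habar halpha hN1.
  have hu : abar (alpha * u ^+ 2) by apply/classP; exists u.
  exists (valpha alpha), (valpha (alpha * u ^+ 2)); split.
    rewrite -subset0 => w [] /qform_orbit[c Kc qc] /qform_orbit[d Kd qd].
    (* Comparing Q on a common point gives c = d u or c = -d u; as -1 is in [K], both would put [u]
       in [K]. *)
    have /eqP : c ^+ 2 = (d * u) ^+ 2.
      by apply: (mulfI alpha0); rewrite mulrC -qc qd; ring.
    rewrite eqf_sqr => /orP[/eqP|/eqP] e; apply: nu.
      by apply: (KMl _ _ Kd); rewrite -e.
    apply: (KMl _ _ Kd).
    rewrite -[d * u]opprK -e -mulN1r.
    exact: (KgroupM hk n2 habar halpha hN1).
  apply/seteqP; split=> w; last by case; exact: sub.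
  move=> /sup[a /classP[t t0 ->]] aw.
  have [Kt|nt] := pselect (Kgroup abar t);
    first by left; exact: rescale halpha Kt _ aw.
  right; apply: (rescale _ (t / u) hu); last first.
    by have -> : alpha * u ^+ 2 * (t / u) ^+ 2 = alpha * t ^+ 2 by field.
  (* Both u and t lie outside [K], so u t lies in it by index 2, and t / u differs from u t by the
     square u^2. *)
  apply: (KMl _ _ (Kgroup_sqr hk n2 habar halpha hN1 u0)).
  have -> : u ^+ 2 * (t / u) = u * t by field.
  exact: index2.
- move=> nN1; exists (valpha alpha); apply/seteqP; split=> w; last exact: sub.
  move=> /sup[a /classP[t t0 ->]] aw.
  have [Kt|nt] := pselect (Kgroup abar t); first exact: rescale halpha Kt _ aw.
  (* Neither -1 nor t is in [K], so -t is, and it has the same square as t. *)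
  have KNt := index2 _ _ N10 t0 nN1 nt.
  by apply: (rescale _ _ halpha KNt); rewrite mulN1r sqrrN.
Qed.
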